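(* In the non-preemptive sUETS problem, the online algorithm that, whenever a machine is available and an unprocessed job remains, assigns a batch consisting of a single unprocessed job to that machine, is $O(n/m)$-competitive; that is, there is an absolute constant $C$ such that its makespan is at most $C\cdot(n/m)$ times the optimal makespan on every instance.
   Context: Non-preemptive sUETS: a finite set $J$ of $n$ jobs and $m$ identical machines, $n\ge m\ge 2$, all jobs available at time $0$. A known setup-time function $c:2^J\to\mathbb{R}_{\ge0}$ is monotone ($c(X)\le c(Y)$ for $X\subseteq Y$) and subadditive ($c(X)+c(Y)\ge c(X\cup Y)$ for disjoint $X,Y$). Each job $j$ has execution time $p_j\ge0$, unknown to an online algorithm until $j$ completes; $p(X)=\sum_{j\in X}p_j$. An algorithm repeatedly forms batches (sets of jobs not completed and not assigned elsewhere) and assigns each batch to a single idle machine, which processes batch $X$ without interruption in time $c(X)+p(X)$. The makespan is the completion time of all jobs. The optimal makespan is $\min_{(X_1,\dots,X_m)\text{ partition of }J}\max_{i}(c(X_i)+p(X_i))$. An algorithm is $\rho$-competitive if its makespan is at most $\rho$ times the optimal makespan on every instance. *)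

(* Defs.v *)
From mathcomp Require Import all_boot all_order all_algebra.
From mathcomp Require Import reals.
Set Implicit Arguments.
Unset Strict Implicit.
Unset Printing Implicit Defensive.
Import Order.TTheory GRing.Theory Num.Theory.
Local Open Scope ring_scope.

Definition setup_time (R : realType) (J : finType) (c : {set J} -> R) : Prop :=
  [/\ forall X : {set J}, 0 <= c X,
      forall X Y : {set J}, X \subset Y -> c X <= c Y &
      forall X Y : {set J}, [disjoint X & Y] -> c (X :|: Y) <= c X + c Y].

Definition processing_time (R : realType) (J : finType)
    (c : {set J} -> R) (p : J -> R) (X : {set J}) : R :=
  c X + \sum_(j in X) p j.

(* Parts may be empty. *)
Definition job_partition (J : finType) (m : nat)
    (X : {ffun 'I_m -> {set J}}) : bool :=
  [forall i, forall k, (i != k) ==> [disjoint X i & X k]] &&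
  (\bigcup_i X i == [set: J]).

(* For m > 0 and an admissible setup function, the default value of the
   minimum is itself the value of a partition: the one that puts all the jobs
   on one machine. *)
Definition opt_makespan (R : realType) (J : finType) (m : nat)
    (c : {set J} -> R) (p : J -> R) : R :=
  \big[Num.min/processing_time c p [set: J]]_(X : {ffun 'I_m -> {set J}}
                                              | job_partition X)
     \big[Num.max/0]_(i < m) processing_time c p (X i).

(* What an online algorithm observes at a given moment: the clock, the batch
   run by each machine with its starting time (None if the machine is idle),
   and the execution time of each job that has completed (None for the other
   jobs). *)
Record config (R : realType) (J : finType) (m : nat) := Config {
  now : R;
  running : 'I_m -> option ({set J} * R);
  revealed : J -> option R
}.

Definition idle (R : realType) (J : finType) (m : nat)
    (s : config R J m) (i : 'I_m) : bool :=
  ~~ isSome (running s i).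

Definition batch (R : realType) (J : finType) (m : nat)
    (s : config R J m) (i : 'I_m) : {set J} :=
  if running s i is Some (X, _) then X else set0.

Definition completed (R : realType) (J : finType) (m : nat)
    (s : config R J m) : {set J} :=
  [set j | isSome (revealed s j)].

Definition unprocessed (R : realType) (J : finType) (m : nat)
    (s : config R J m) : {set J} :=
  ~: (completed s :|: \bigcup_i batch s i).

(* The algorithm knows J, m, the setup function and the history of
   configurations, the current one first; it either assigns a batch to a
   machine or waits for the next batch completion (None). It has no access to
   the execution times other than through the history. *)
Definition online_algorithm (R : realType) : Type :=
  forall (J : finType) (m : nat),
    ({set J} -> R) -> seq (config R J m) -> option ('I_m * {set J}).

Definition assign (R : realType) (J : finType) (m : nat)
    (s : config R J m) (i : 'I_m) (X : {set J}) : config R J m :=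
  Config (now s)
         (fun k => if k == i then Some (X, now s) else running s k)
         (revealed s).

Definition finish_time (R : realType) (J : finType) (m : nat)
    (c : {set J} -> R) (p : J -> R) (s : config R J m) (i : 'I_m) : R :=
  if running s i is Some (X, t) then t + processing_time c p X else now s.

Definition finishes_next (R : realType) (J : finType) (m : nat)
    (c : {set J} -> R) (p : J -> R) (s : config R J m) (i : 'I_m) : bool :=
  ~~ idle s i &&
  [forall k, ~~ idle s k ==> (finish_time c p s i <= finish_time c p s k)].

(* Advance the clock to the next batch completion; nothing happens if all the
   machines are idle. *)
Definition wait (R : realType) (J : finType) (m : nat)
    (c : {set J} -> R) (p : J -> R) (s : config R J m) : config R J m :=
  if [pick i | finishes_next c p s i] is Some i then
    Config (finish_time c p s i)
           (fun k => if finishes_next c p s k then None else running s k)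
           (fun j => if [exists k, finishes_next c p s k && (j \in batch s k)]
                     then Some (p j) else revealed s j)
  else s.

(* An illegal assignment is treated as a request to wait. *)
Definition step (R : realType) (J : finType) (m : nat)
    (c : {set J} -> R) (p : J -> R) (s : config R J m)
    (d : option ('I_m * {set J})) : config R J m :=
  if d is Some (i, X) then
    if [&& idle s i, X != set0 & X \subset unprocessed s]
    then assign s i X else wait c p s
  else wait c p s.

Definition init_config (R : realType) (J : finType) (m : nat) : config R J m :=
  Config 0 (fun=> None) (fun=> None).

Fixpoint history (R : realType) (A : online_algorithm R) (J : finType)
    (m : nat) (c : {set J} -> R) (p : J -> R) (k : nat) : seq (config R J m) :=
  if k is k'.+1 then
    let h := history A m c p k' in
    step c p (head (init_config R J m) h) (A J m c h) :: h
  else [:: init_config R J m].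

Definition config_after (R : realType) (A : online_algorithm R) (J : finType)
    (m : nat) (c : {set J} -> R) (p : J -> R) (k : nat) : config R J m :=
  head (init_config R J m) (history A m c p k).

(* Once all the jobs have completed no legal assignment is left and the clock
   stops, so T is unique; it exists when the algorithm completes all jobs. *)
Definition has_makespan (R : realType) (A : online_algorithm R) (J : finType)
    (m : nat) (c : {set J} -> R) (p : J -> R) (T : R) : Prop :=
  exists k : nat, completed (config_after A m c p k) = [set: J]
               /\ now (config_after A m c p k) = T.

(* The ratio may depend on the numbers n of jobs and m of machines. *)
Definition competitive (R : realType) (A : online_algorithm R)
    (rho : nat -> nat -> R) : Prop :=
  forall (J : finType) (m : nat) (c : {set J} -> R) (p : J -> R),
    (2 <= m)%N -> (m <= #|J|)%N ->
    setup_time c -> (forall j, 0 <= p j) ->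
    exists T : R, has_makespan A m c p T
               /\ T <= rho #|J| m * opt_makespan m c p.

(* The choice of the job, and of the machine if several are idle, is left to
   the algorithm. As an assignment takes no time, the rule applies again at the
   same instant until no machine is idle or no job is unprocessed. *)
Definition single_job_algorithm (R : realType) (A : online_algorithm R) : Prop :=
  forall (J : finType) (m : nat) (c : {set J} -> R)
         (s : config R J m) (past : seq (config R J m)),
    (exists i, idle s i) -> unprocessed s != set0 ->
    exists (i : 'I_m) (j : J),
      [/\ idle s i, j \in unprocessed s & A J m c (s :: past) = Some (i, [set j])].

Lemma single_job_algorithm_exists (R : realType) :
  exists A : online_algorithm R, single_job_algorithm A.
Proof.
exists (fun J m c h =>
  if h is s :: _ then
    if [pick i | idle s i] is Some i then
      if [pick j in unprocessed s] is Some j then Some (i, [set j]) else None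
    else None
  else None) => J m c s past [i0 idle_i0] /set0Pn[j0 j0P].
case: pickP => [i idle_i|/(_ i0)]; last by rewrite idle_i0.
case: pickP => [j jP|/(_ j0)]; last by rewrite j0P.
by exists i, j.
Qed.

(* Main.v *)
(** Every singleton batch takes time at most OPT, by monotonicity of the setup
    function. As long as a job is unprocessed no machine ever idles, so the
    finish times of the [m] machines add up to the total length of the batches
    assigned so far, which is at most [n * OPT]. Hence every batch starts by
    time [(n / m) * OPT] and ends by [(n / m + 1) * OPT <= 2 (n / m) * OPT]. *)

Require Import Defs.
From mathcomp Require Import all_boot all_order all_algebra.
From mathcomp Require Import reals.
Set Implicit Arguments.
Unset Strict Implicit.
Unset Printing Implicit Defensive.
Import Order.TTheory GRing.Theory Num.Theory.
Local Open Scope ring_scope.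

(** * Processing times and the lower bound on the optimum *)

Section ProcessingTime.
Context {R : realType} {J : finType} {c : {set J} -> R} {p : J -> R}.
Hypotheses (setup_c : setup_time c) (p_ge0 : forall j, 0 <= p j).

Lemma processing_time_ge0 X : 0 <= processing_time c p X.
Proof. by case: setup_c => c_ge0 _ _; rewrite addr_ge0 ?sumr_ge0. Qed.

Lemma le_processing_time (X Y : {set J}) :
  X \subset Y -> processing_time c p X <= processing_time c p Y.
Proof.
case: setup_c => _ c_mono _ XY; apply: lerD; first exact: c_mono.
rewrite [leRHS](big_setID X) /= (setIidPr XY) lerDl.
exact: sumr_ge0.
Qed.

(** In any partition the part containing [j] takes at least as long as [j] alone. The default value
    of the minimum is handled in the same way, since [[set: J]] contains [j]. *)
Lemma processing_time1_le_opt (m : nat) (j : J) :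
  processing_time c p [set j] <= opt_makespan m c p.
Proof.
rewrite /opt_makespan; elim/big_rec: _ => [|X T /andP[_ /eqP coverX] le_T].
  by apply: le_processing_time; exact: subsetT.
rewrite le_min le_T andbT.
have /bigcupP[i _ jXi] : j \in \bigcup_i X i by rewrite coverX inE.
by apply: le_trans (le_bigmax _ _ i); apply: le_processing_time; rewrite sub1set.
Qed.

End ProcessingTime.

(** * Effect of assigning and waiting on a configuration *)

Section Transitions.
Context {R : realType} {J : finType} {m : nat} (c : {set J} -> R) (p : J -> R).
Implicit Types (s : config R J m) (i : 'I_m).

Lemma finish_time_idle s i : idle s i -> finish_time c p s i = now s.
Proof. by rewrite /idle /finish_time; case: running. Qed.

Lemma finish_time_assign s i X k :
  finish_time c p (assign s i X) k =
  if k == i then now s + processing_time c p X else finish_time c p s k.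
Proof. by rewrite /finish_time /=; case: eqP. Qed.

Lemma unprocessed_assign s i X :
  idle s i -> unprocessed (assign s i X) = unprocessed s :\: X.
Proof.
move=> idle_i; apply/setP=> j; rewrite !inE !negb_or andbCA; congr andb.
rewrite -negb_or; congr negb; apply/bigcupP/orP => [[k _]|[jX|/bigcupP[k _ jk]]].
- rewrite /batch /=; case: eqP => [_|_ jk]; first by left.
  by right; apply/bigcupP; exists k.
- by exists i => //; rewrite /batch /= eqxx.
- exists k => //; move: jk; rewrite /batch /=; case: eqP => // ->.
  by move: idle_i; rewrite /idle; case: running => // _; rewrite inE.
Qed.

Lemma finishes_next_running s i : finishes_next c p s i -> ~~ idle s i.
Proof. by case/andP. Qed.

Lemma finishes_next_le s i k :
  finishes_next c p s i -> ~~ idle s k ->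
  finish_time c p s i <= finish_time c p s k.
Proof. by case/andP=> _ /forallP/(_ k)/implyP. Qed.

Lemma exists_finishes_next s i :
  ~~ idle s i -> exists k, finishes_next c p s k.
Proof.
move=> run_i.
case: (@arg_minP _ _ _ i (fun k => ~~ idle s k) (finish_time c p s) run_i).
move=> k run_k le_k; exists k; rewrite /finishes_next run_k.
by apply/forallP => l; apply/implyP/le_k.
Qed.

(** Waiting changes [finish_time] only on machines that were already idle, which follow the clock. A
    machine that has just finished reports the new clock, which is its old finish time. *)
Variant wait_spec s : config R J m -> Prop :=
| WaitIdle of (forall i, idle s i) : wait_spec s s
| WaitFinish s' i of finishes_next c p s i
    & now s' = finish_time c p s i
    & (forall k, idle s' k = idle s k || finishes_next c p s k)
    & (forall k, finish_time c p s' k =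
                 if idle s k then now s' else finish_time c p s k)
    & unprocessed s' = unprocessed s : wait_spec s s'.

Lemma waitP s : wait_spec s (wait c p s).
Proof.
rewrite /wait; case: pickP => [i fin_i|no_fin]; last first.
  apply: WaitIdle => i; have [//|/exists_finishes_next[k]] := boolP (idle s i).
  by rewrite no_fin.
apply: (@WaitFinish _ _ i) => //.
- by move=> k; rewrite /idle /=; case: ifP; rewrite ?orbT ?orbF.
- move=> k; rewrite {1}/finish_time /=; case: ifPn => [fin_k|_].
    (* Machines that finish next together have equal finish times, by antisymmetry. *)
    rewrite (negPf (finishes_next_running fin_k)); apply/eqP.
    have run_i := finishes_next_running fin_i.
    have run_k := finishes_next_running fin_k.
    by rewrite eq_le !finishes_next_le.
  by rewrite /idle /finish_time; case: (running s k) => [[]|].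
(* Jobs of finished batches only move from the running batches to [completed], so the union of the
   two is unchanged. *)
apply/setP=> j; rewrite !inE; congr negb.
apply/idP/idP => /orP[|/bigcupP[k _ jk]].
- rewrite /=; case: ifP => [/existsP[k /andP[_ jk]] _|_ ->//].
  by apply/orP; right; apply/bigcupP; exists k.
- apply/orP; right; apply/bigcupP; exists k => //.
  by move: jk; rewrite /batch /=; case: ifP; rewrite ?inE.
- by rewrite /=; case: ifP => // _ ->.
- rewrite /=; case: ifPn => //= no_k.
  apply/orP; right; apply/bigcupP; exists k => //.
  rewrite /batch /= ifN //; apply: contra no_k => fin_k.
  by apply/existsP; exists k; rewrite fin_k.
Qed.

(* Counting an unprocessed job twice makes an assignment lower the potential
   too. *)
Definition pending_work s : nat :=
  (2 * #|unprocessed s| + #|[set i | ~~ idle s i]|)%N.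

Lemma pending_work_assign s i j :
  idle s i -> j \in unprocessed s ->
  (pending_work (assign s i [set j]) < pending_work s)%N.
Proof.
move=> idle_i jU; rewrite /pending_work unprocessed_assign //.
rewrite (cardsD1 j (unprocessed s)) jU.
suff -> : [set k | ~~ idle (assign s i [set j]) k] = i |: [set k | ~~ idle s k].
  rewrite cardsU1 inE idle_i /= mulnDr muln1 addnCA.
  by rewrite -addnA ltn_add2r.
by apply/setP=> k; rewrite !inE /idle /=; case: eqP.
Qed.

Lemma pending_work_wait s i :
  ~~ idle s i -> (pending_work (wait c p s) < pending_work s)%N.
Proof.
move=> run_i; rewrite /pending_work; case: waitP => [/(_ i)|].
  by rewrite (negPf run_i).
move=> s' k fin_k _ idle_s' _ ->; rewrite ltn_add2l; apply: proper_card.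
apply/properP; split.
  by apply/subsetP => l; rewrite !inE idle_s' negb_or => /andP[].
by exists k; rewrite !inE ?idle_s' ?fin_k ?orbT ?(finishes_next_running fin_k).
Qed.

End Transitions.

Arguments waitP {R J m} c p s.

(** * Greedy scheduling of single jobs of length at most [W] *)

Section ListScheduling.
Context {R : realType} {J : finType} {m : nat} (c : {set J} -> R) (p : J -> R).
Context (W : R).
Hypothesis W_ge0 : 0 <= W.
Hypothesis job_ge0 : forall j, 0 <= processing_time c p [set j].
Hypothesis job_leW : forall j, processing_time c p [set j] <= W.
Implicit Types s : config R J m.

(* [finish_time] of an idle machine is the current time, so the sum below is
   [m * now s] plus the remaining work of the running batches. *)
Definition greedy_invariant s : Prop :=
  [/\ forall i, now s <= finish_time c p s i,
      forall i, m%:R * finish_time c p s i <= (#|J| + m)%:R * W &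
      unprocessed s != set0 ->
        \sum_i finish_time c p s i <= #|~: unprocessed s|%:R * W].

Lemma greedy_invariant_init : greedy_invariant (init_config R J m).
Proof.
split=> [//|i|_]; first by rewrite mulr0 mulr_ge0.
by rewrite big1 // mulr_ge0.
Qed.

Lemma greedy_invariant_assign s i j :
  greedy_invariant s -> idle s i -> j \in unprocessed s ->
  greedy_invariant (assign s i [set j]).
Proof.
case=> le_now le_fin le_sum idle_i jU.
have {}le_sum : \sum_i finish_time c p s i <= #|~: unprocessed s|%:R * W.
  by apply: le_sum; apply/set0Pn; exists j.
split=> [k|k|_].
- by rewrite finish_time_assign; case: eqP => // _; rewrite lerDl.
(* No finish time is below [now s], so [m * now s] is at most their sum, hence at most [#|J| * W].
   The new batch, scaled by [m], adds at most [m * W]. *)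
- rewrite finish_time_assign; case: eqP => // _.
  rewrite mulrDr natrD mulrDl lerD ?ler_wpM2l //.
  have -> : m%:R * now s = \sum_(i < m) now s.
    by rewrite sumr_const card_ord mulr_natl.
  apply: (le_trans (ler_sum _ (fun k _ => le_now k))).
  by apply: le_trans le_sum _; rewrite ler_wpM2r // ler_nat max_card.
(* The finish time of [i] rises from [now s] by at most [W], while one more job stops being
   unprocessed. *)
- rewrite unprocessed_assign // setCD setUC cardsU1 inE jU natrD mulrDl mul1r.
  rewrite (bigD1 i) //= finish_time_assign eqxx addrAC addrC.
  apply: lerD => //; apply: le_trans le_sum.
  rewrite [leRHS](bigD1 i) //= finish_time_idle // lerD2l ler_sum // => k /negPf k_i.
  by rewrite finish_time_assign k_i.
Qed.

(** Idle machines see their finish time rise with the clock, which could break the bound on the sum.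
    The disjunction prevents this: either no machine is idle, or no job is unprocessed and that
    bound is not claimed. *)
Lemma greedy_invariant_wait s :
  greedy_invariant s -> unprocessed s = set0 \/ (forall i, ~~ idle s i) ->
  greedy_invariant (wait c p s).
Proof.
move=> inv_s; case: (inv_s) => le_now le_fin le_sum busy.
case: waitP => // s' i fin_i now_s' _ fin_s' U_s'; split=> [k|k|].
- rewrite fin_s'; case: ifPn => // run_k.
  by rewrite now_s'; exact: finishes_next_le.
(* An idle machine inherits the finish time of [i], which already satisfies the bound. *)
- by rewrite fin_s' now_s'; case: ifP.
- rewrite U_s' => U_n0; case: busy => [U0|run]; first by rewrite U0 eqxx in U_n0.
  by rewrite (eq_bigr (finish_time c p s)) ?le_sum // => k _; rewrite fin_s' ifN.
Qed.

Context (A : online_algorithm R).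
Hypothesis A_single : single_job_algorithm A.

Lemma config_afterS k : exists past,
  config_after A m c p k.+1 =
  step c p (config_after A m c p k)
       (@A J m c (config_after A m c p k :: past)).
Proof. by rewrite /config_after; case: k => [|k]; eexists. Qed.

(** The single-job rule is silent when no machine is idle or no job is unprocessed, but then every
    assignment is illegal and [step] turns it into a wait. *)
Lemma step_single_job s past :
  let s' := step c p s (@A J m c (s :: past)) in
  (exists i j, [/\ idle s i, j \in unprocessed s & s' = assign s i [set j]]) \/
  (s' = wait c p s /\ (unprocessed s = set0 \/ forall i, ~~ idle s i)).
Proof.
case: (boolP [exists i, idle s i]) => [/existsP ex_idle|no_idle]; last first.
  have run i : ~~ idle s i.
    by apply: contra no_idle => idle_i; apply/existsP; exists i.
  right; split; last by right.
  by rewrite /step; case: A => [[i X]|] //; rewrite (negPf (run i)).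
have [U0|U_n0] := eqVneq (unprocessed s) set0.
  right; split; last by left.
  rewrite /step; case: A => [[i X]|] //; rewrite U0 subset0.
  by case: eqP; rewrite ?andbF.
have [i [j [idle_i jU ->]]] := @A_single J m c s past ex_idle U_n0.
left; exists i, j; split=> //=; rewrite idle_i sub1set jU andbT /=.
by rewrite ifT //; apply/set0Pn; exists j; rewrite inE.
Qed.

Lemma greedy_invariant_config_after k :
  greedy_invariant (config_after A m c p k).
Proof.
elim: k => [|k IHk]; first exact: greedy_invariant_init.
have [past ->] := config_afterS k.
case: (step_single_job (config_after A m c p k) past).
  by move=> [i [j [idle_i jU ->]]]; exact: greedy_invariant_assign.
by case=> -> busy; exact: greedy_invariant_wait.
Qed.

(** Each step lowers [pending_work], unless all machines are idle and no job is unprocessed; in that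
    case all batches are empty and every job is completed. *)
Lemma single_job_completes :
  (0 < m)%N -> exists k, completed (config_after A m c p k) = [set: J].
Proof.
move=> m_gt0; suff complete_from n k :
    (pending_work (config_after A m c p k) < n)%N ->
    exists l, completed (config_after A m c p l) = [set: J].
  exact: (complete_from _ 0%N (ltnSn _)).
elim: n k => // n IHn k; rewrite ltnS => le_n.
have [past next] := config_afterS k.
have continue : (pending_work (config_after A m c p k.+1) <
                 pending_work (config_after A m c p k))%N ->
    exists l, completed (config_after A m c p l) = [set: J].
  by move=> lt_k; apply: (IHn k.+1); exact: leq_trans lt_k le_n.
move: continue; rewrite {}next; set s := config_after A m c p k.
case: (step_single_job s past) => [[i [j [idle_i jU ->]]]|[-> busy]].
  by apply; exact: pending_work_assign.
case: (boolP [forall i, idle s i]) => [/forallP all_idle _|]; last first.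
  by move=> /forallPn[i run_i]; apply; exact: pending_work_wait run_i.
case: busy => [U0|/(_ (Ordinal m_gt0))]; last by rewrite all_idle.
exists k; apply: setC_inj; rewrite setCT -U0 /unprocessed big1 ?setU0 // => i _.
by have := all_idle i; rewrite /idle /batch; case: running.
Qed.

Lemma single_job_makespan :
  (0 < m)%N ->
  exists T, has_makespan A m c p T /\ m%:R * T <= (#|J| + m)%:R * W.
Proof.
move=> m_gt0; have [k done_k] := single_job_completes m_gt0.
exists (now (config_after A m c p k)); split; first by exists k.
have [le_now le_fin _] := greedy_invariant_config_after k.
apply: le_trans (le_fin (Ordinal m_gt0)).
by rewrite ler_wpM2l.
Qed.

End ListScheduling.

Theorem theorem3 (R : realType) :
  exists C : R, forall A : online_algorithm R,
    single_job_algorithm A ->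
    competitive A (fun n m : nat => C * (n%:R / m%:R)).
Proof.
(* The constant comes from [n + m <= 2 * n], as [m <= n]. *)
exists 2 => A A_single J m c p m_ge2 m_leJ setup_c p_ge0.
have m_gt0 : (0 < m)%N := ltnW m_ge2.
(* Some job exists, and its nonnegative processing time shows that the optimum is nonnegative. *)
have [j0 _] : exists j0 : J, j0 \in J.
  by apply/card_gt0P; exact: leq_trans m_leJ.
have job_ge0 j : 0 <= processing_time c p [set j] by exact: processing_time_ge0.
have job_le_opt := processing_time1_le_opt setup_c p_ge0 m.
have opt_ge0 := le_trans (job_ge0 j0) (job_le_opt j0).
have [T [makespanT le_T]] :=
  single_job_makespan opt_ge0 job_ge0 job_le_opt A_single m_gt0.
exists T; split=> //.
rewrite mulrA mulrAC ler_pdivlMr ?ltr0n // mulrC; apply: le_trans le_T _.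
by rewrite ler_wpM2r // -natrM ler_nat mul2n -addnn leq_add2l.
Qed.
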